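(* Let $\Lambda$ be a set of standard formulas closed under standard substitution. For every formula $\phi$ of the inquisitive language $\mathcal{L}$ (built from $\wedge,\vee,\to,\bot$), we have $\phi\in \mathtt{inq}\Lambda$ if and only if $\phi$ is valid (under core semantics) in every $\mathtt{inq}\Lambda$-algebra. Likewise, for every formula $\phi$ of the dependence language $\mathcal{L}^{\otimes}$ (built from $\wedge,\vee,\to,\otimes,\bot$), we have $\phi\in \mathtt{inq}\Lambda^{\otimes}$ if and only if $\phi$ is valid (under core semantics) in every $\mathtt{inq}\Lambda^{\otimes}$-algebra.
   Context: Fix a countable set of propositional atoms. Let $\mathcal{L}$ be the set of formulas generated by $\phi::=p\mid\bot\mid\phi\wedge\phi\mid\phi\vee\phi\mid\phi\to\phi$, and $\mathcal{L}^{\otimes}$ the set of formulas generated by the same grammar plus $\phi\otimes\phi$ (tensor disjunction). A formula is standard if it contains no $\vee$; write $\mathcal{L}_{\mathrm{st}}$, $\mathcal{L}^{\otimes}_{\mathrm{st}}$ for the standard formulas. A set of formulas is closed under standard substitution if it is closed under every substitution of standard formulas for atoms. Intuitionistic inquisitive logic $\mathtt{inqI}$ is the smallest set of formulas of $\mathcal{L}$ containing all instances of the usual Hilbert axioms of intuitionistic propositional logic together with the Split axiom $(\alpha\to(\phi\vee\psi))\to((\alpha\to\phi)\vee(\alpha\to\psi))$ for $\alpha$ standard, and closed under modus ponens. Intuitionistic dependence logic $\mathtt{inqI}^{\otimes}$ is the smallest set of formulas of $\mathcal{L}^{\otimes}$ containing these axioms (Split for $\alpha\in\mathcal{L}^{\otimes}_{\mathrm{st}}$)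 and, for arbitrary $\phi,\psi,\chi,\tau$ and standard $\alpha,\beta,\gamma$: $\alpha\to(\alpha\otimes\beta)$; $(\alpha\otimes\beta)\to(\beta\otimes\alpha)$; $\phi\otimes(\psi\vee\chi)\to(\phi\otimes\psi)\vee(\phi\otimes\chi)$; $(\phi\to\chi)\to((\psi\to\tau)\to(\phi\otimes\psi\to\chi\otimes\tau))$; $(\alpha\to\gamma)\to((\beta\to\gamma)\to(\alpha\otimes\beta\to\gamma))$; closed under modus ponens. For $\Lambda\subseteq\mathcal{L}_{\mathrm{st}}$ closed under standard substitution, the intermediate inquisitive logic $\mathtt{inq}\Lambda$ is the closure of $\mathtt{inqI}\cup\Lambda$ under modus ponens; for $\Lambda\subseteq\mathcal{L}^{\otimes}_{\mathrm{st}}$ closed under standard substitution, the intermediate dependence logic $\mathtt{inq}\Lambda^{\otimes}$ is the closure of $\mathtt{inqI}^{\otimes}\cup\Lambda$ under modus ponens. An inquisitive algebra is a structure $\mathcal{A}=(A,A_c,\wedge,\vee,\to,0)$ with a distinguished subset $A_c\subseteq A$ (the core) such that: the closure $\langle A_c\rangle$ of $A_c$ under $\wedge,\vee,\to,0$ is a Heyting algebra; $(A_c,\wedge,\to,0)$ is a Brouwerian semilattice; and for all $x,y\in\langle A_c\rangle$, $a\in A_c$: $a\to(x\vee y)=(a\to x)\vee(a\to y)$. A dependence algebra is a structure $(A,A_c,\wedge,\otimes,\vee,\to,0)$ such that $\langle A_c\rangle$ (closure under $\vee,\otimes,\wedge,\to,0$) is a Heyting algebra, $(A_c,\otimes,\wedge,\to,0)$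 is a Heyting algebra (with $\otimes$ as join), and for all $x,y,z,k\in\langle A_c\rangle$, $a\in A_c$: $a\to(x\vee y)=(a\to x)\vee(a\to y)$, $x\otimes(y\vee z)=(x\otimes y)\vee(x\otimes z)$, and $(x\to z)\to(y\to k)=(x\otimes y)\to(z\otimes k)$. A core valuation on such an algebra is a map $\mu$ from atoms into $A_c$. The interpretation of formulas in the model $(\mathcal{A},\mu)$ is defined recursively: an atom $p$ is interpreted as $\mu(p)$, $\bot$ as $0$, and $\wedge,\vee,\to$ (and $\otimes$ for dependence algebras) are interpreted by the corresponding algebra operations. A formula is true in $(\mathcal{A},\mu)$ if its interpretation equals $1:=0\to0$, and valid (under core semantics) in $\mathcal{A}$ if it is true in $(\mathcal{A},\mu)$ for every core valuation $\mu$. An inquisitive algebra is an $\mathtt{inq}\Lambda$-algebra if every formula of $\Lambda$ is valid in it; a dependence algebra is an $\mathtt{inq}\Lambda^{\otimes}$-algebra if every formula of $\Lambda$ is valid in it.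
   Formalization: In the definition of dependence algebra, the condition (x→z)→(y→k) = (x⊗y)→(z⊗k), which forces 0 = 1, is replaced by (x→z)→((y→k)→((x⊗y)→(z⊗k))) = 1, the algebraic form of the logic's monotonicity axiom for ⊗. *)

(* Defs.v *)
From mathcomp Require Import all_boot.

Set Implicit Arguments.
Unset Strict Implicit.
Unset Printing Implicit Defensive.

Inductive mp_closure (F : Type) (imp : F -> F -> F) (S : F -> Prop) : F -> Prop :=
| mp_base f : S f -> mp_closure imp S f
| mp_step f g : mp_closure imp S (imp f g) -> mp_closure imp S f ->
                mp_closure imp S g.

Inductive ipl_axiom (F : Type) (bot : F) (and or imp : F -> F -> F) : F -> Prop :=
| ipl_k f g : ipl_axiom bot and or imp (imp f (imp g f))
| ipl_s f g h : ipl_axiom bot and or imp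
    (imp (imp f (imp g h)) (imp (imp f g) (imp f h)))
| ipl_andl f g : ipl_axiom bot and or imp (imp (and f g) f)
| ipl_andr f g : ipl_axiom bot and or imp (imp (and f g) g)
| ipl_andi f g : ipl_axiom bot and or imp (imp f (imp g (and f g)))
| ipl_orl f g : ipl_axiom bot and or imp (imp f (or f g))
| ipl_orr f g : ipl_axiom bot and or imp (imp g (or f g))
| ipl_ore f g h : ipl_axiom bot and or imp
    (imp (imp f h) (imp (imp g h) (imp (or f g) h)))
| ipl_bot f : ipl_axiom bot and or imp (imp bot f).

(* Brouwerian semilattices and Heyting algebras carried by a subset D of A;
   the order is the one of the meet operation. *)

Record brouwerian_on (A : Type) (D : A -> Prop)
    (meet imp : A -> A -> A) (bot : A) : Prop := BrouwerianOn {
  bs_bot_in : D bot;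
  bs_meet_in : forall x y, D x -> D y -> D (meet x y);
  bs_imp_in : forall x y, D x -> D y -> D (imp x y);
  bs_meetxx : forall x, D x -> meet x x = x;
  bs_meetC : forall x y, D x -> D y -> meet x y = meet y x;
  bs_meetA : forall x y z, D x -> D y -> D z ->
    meet x (meet y z) = meet (meet x y) z;
  bs_bot_le : forall x, D x -> meet bot x = bot;
  bs_residuation : forall x y z, D x -> D y -> D z ->
    meet (meet z x) y = meet z x <-> meet z (imp x y) = z
}.

Record heyting_on (A : Type) (D : A -> Prop)
    (meet join imp : A -> A -> A) (bot : A) : Prop := HeytingOn {
  ha_brouwerian : brouwerian_on D meet imp bot;
  ha_join_in : forall x y, D x -> D y -> D (join x y);
  ha_joinC : forall x y, D x -> D y -> join x y = join y x;
  ha_joinA : forall x y z, D x -> D y -> D z ->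
    join x (join y z) = join (join x y) z;
  ha_meetKU : forall x y, D x -> D y -> join x (meet x y) = x;
  ha_joinKI : forall x y, D x -> D y -> meet x (join x y) = x
}.

(** Inquisitive logic *)

Inductive form (V : Type) : Type :=
| Atom of V
| Bot
| And of form V & form V
| Or of form V & form V
| Imp of form V & form V.

Arguments Bot {V}.

Fixpoint standard (V : Type) (f : form V) : bool :=
  match f with
  | Atom _ | Bot => true
  | And g h | Imp g h => standard g && standard h
  | Or _ _ => false
  end.

Fixpoint subst (V : Type) (s : V -> form V) (f : form V) : form V :=
  match f with
  | Atom p => s p
  | Bot => Bot
  | And g h => And (subst s g) (subst s h)
  | Or g h => Or (subst s g) (subst s h)
  | Imp g h => Imp (subst s g) (subst s h)
  end.

Definition closed_std_subst (V : Type) (L : form V -> Prop) : Prop :=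
  forall s : V -> form V, (forall p, standard (s p)) ->
  forall f, L f -> L (subst s f).

Inductive inqI_axiom (V : Type) : form V -> Prop :=
| inqI_ipl f : ipl_axiom Bot (@And V) (@Or V) (@Imp V) f -> inqI_axiom f
| inqI_split a f g : standard a ->
    inqI_axiom (Imp (Imp a (Or f g)) (Or (Imp a f) (Imp a g))).

Definition inqI (V : Type) : form V -> Prop :=
  mp_closure (@Imp V) (@inqI_axiom V).

Definition inq (V : Type) (L : form V -> Prop) : form V -> Prop :=
  mp_closure (@Imp V) (fun f => inqI f \/ L f).

Inductive inq_generated (A : Type) (core : A -> Prop)
    (meet join imp : A -> A -> A) (bot : A) : A -> Prop :=
| ig_core a : core a -> inq_generated core meet join imp bot a
| ig_bot : inq_generated core meet join imp bot bot
| ig_meet x y : inq_generated core meet join imp bot x ->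
    inq_generated core meet join imp bot y ->
    inq_generated core meet join imp bot (meet x y)
| ig_join x y : inq_generated core meet join imp bot x ->
    inq_generated core meet join imp bot y ->
    inq_generated core meet join imp bot (join x y)
| ig_imp x y : inq_generated core meet join imp bot x ->
    inq_generated core meet join imp bot y ->
    inq_generated core meet join imp bot (imp x y).

Record inqAlgebra : Type := InqAlgebra {
  ia_sort :> Type;
  ia_core : ia_sort -> Prop;
  ia_meet : ia_sort -> ia_sort -> ia_sort;
  ia_join : ia_sort -> ia_sort -> ia_sort;
  ia_imp : ia_sort -> ia_sort -> ia_sort;
  ia_bot : ia_sort;
  ia_gen := inq_generated ia_core ia_meet ia_join ia_imp ia_bot;
  ia_heyting : heyting_on ia_gen ia_meet ia_join ia_imp ia_bot;
  ia_brouwerian : brouwerian_on ia_core ia_meet ia_imp ia_bot;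
  ia_split : forall a x y, ia_core a -> ia_gen x -> ia_gen y ->
    ia_imp a (ia_join x y) = ia_join (ia_imp a x) (ia_imp a y)
}.

Definition ia_top (A : inqAlgebra) : A := ia_imp (ia_bot A) (ia_bot A).

Fixpoint ia_eval (V : Type) (A : inqAlgebra) (mu : V -> A) (f : form V) : A :=
  match f with
  | Atom p => mu p
  | Bot => ia_bot A
  | And g h => ia_meet (ia_eval mu g) (ia_eval mu h)
  | Or g h => ia_join (ia_eval mu g) (ia_eval mu h)
  | Imp g h => ia_imp (ia_eval mu g) (ia_eval mu h)
  end.

Definition ia_valid (V : Type) (A : inqAlgebra) (f : form V) : Prop :=
  forall mu : V -> A, (forall p, ia_core (mu p)) -> ia_eval mu f = ia_top A.

Definition is_inq_algebra (V : Type) (L : form V -> Prop) (A : inqAlgebra) : Prop :=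
  forall f, L f -> ia_valid A f.

(** Dependence logic *)

Inductive dform (V : Type) : Type :=
| DAtom of V
| DBot
| DAnd of dform V & dform V
| DOr of dform V & dform V
| DImp of dform V & dform V
| DTen of dform V & dform V.

Arguments DBot {V}.

Fixpoint dstandard (V : Type) (f : dform V) : bool :=
  match f with
  | DAtom _ | DBot => true
  | DAnd g h | DImp g h | DTen g h => dstandard g && dstandard h
  | DOr _ _ => false
  end.

Fixpoint dsubst (V : Type) (s : V -> dform V) (f : dform V) : dform V :=
  match f with
  | DAtom p => s p
  | DBot => DBot
  | DAnd g h => DAnd (dsubst s g) (dsubst s h)
  | DOr g h => DOr (dsubst s g) (dsubst s h)
  | DImp g h => DImp (dsubst s g) (dsubst s h)
  | DTen g h => DTen (dsubst s g) (dsubst s h)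
  end.

Definition dclosed_std_subst (V : Type) (L : dform V -> Prop) : Prop :=
  forall s : V -> dform V, (forall p, dstandard (s p)) ->
  forall f, L f -> L (dsubst s f).

Inductive dinqI_axiom (V : Type) : dform V -> Prop :=
| dinqI_ipl f : ipl_axiom DBot (@DAnd V) (@DOr V) (@DImp V) f -> dinqI_axiom f
| dinqI_split a f g : dstandard a ->
    dinqI_axiom (DImp (DImp a (DOr f g)) (DOr (DImp a f) (DImp a g)))
| dinqI_ten_intro a b : dstandard a -> dstandard b ->
    dinqI_axiom (DImp a (DTen a b))
| dinqI_ten_comm a b : dstandard a -> dstandard b ->
    dinqI_axiom (DImp (DTen a b) (DTen b a))
| dinqI_ten_dist f g h :
    dinqI_axiom (DImp (DTen f (DOr g h)) (DOr (DTen f g) (DTen f h)))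
| dinqI_ten_mon f g h k :
    dinqI_axiom (DImp (DImp f h) (DImp (DImp g k) (DImp (DTen f g) (DTen h k))))
| dinqI_ten_elim a b c : dstandard a -> dstandard b -> dstandard c ->
    dinqI_axiom (DImp (DImp a c) (DImp (DImp b c) (DImp (DTen a b) c))).

Definition dinqI (V : Type) : dform V -> Prop :=
  mp_closure (@DImp V) (@dinqI_axiom V).

Definition dinq (V : Type) (L : dform V -> Prop) : dform V -> Prop :=
  mp_closure (@DImp V) (fun f => dinqI f \/ L f).

Inductive dep_generated (A : Type) (core : A -> Prop)
    (meet join imp ten : A -> A -> A) (bot : A) : A -> Prop :=
| dg_core a : core a -> dep_generated core meet join imp ten bot a
| dg_bot : dep_generated core meet join imp ten bot bot
| dg_meet x y : dep_generated core meet join imp ten bot x ->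
    dep_generated core meet join imp ten bot y ->
    dep_generated core meet join imp ten bot (meet x y)
| dg_join x y : dep_generated core meet join imp ten bot x ->
    dep_generated core meet join imp ten bot y ->
    dep_generated core meet join imp ten bot (join x y)
| dg_imp x y : dep_generated core meet join imp ten bot x ->
    dep_generated core meet join imp ten bot y ->
    dep_generated core meet join imp ten bot (imp x y)
| dg_ten x y : dep_generated core meet join imp ten bot x ->
    dep_generated core meet join imp ten bot y ->
    dep_generated core meet join imp ten bot (ten x y).

(* Writing * for the tensor: its monotonicity condition is sometimes printed as
     (x -> z) -> (y -> k) = (x * y) -> (z * k).
   Taken literally, this forces 1 = 0, hence a one-element generated subalgebra
   in which every formula is valid (literal_mon_collapse below).  The condition
   da_mon is the algebraic counterpart of the axiom dinqI_ten_mon: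
     (x -> z) -> ((y -> k) -> ((x * y) -> (z * k))) = 1. *)
Record depAlgebra : Type := DepAlgebra {
  da_sort :> Type;
  da_core : da_sort -> Prop;
  da_meet : da_sort -> da_sort -> da_sort;
  da_join : da_sort -> da_sort -> da_sort;
  da_imp : da_sort -> da_sort -> da_sort;
  da_ten : da_sort -> da_sort -> da_sort;
  da_bot : da_sort;
  da_gen := dep_generated da_core da_meet da_join da_imp da_ten da_bot;
  da_heyting : heyting_on da_gen da_meet da_join da_imp da_bot;
  da_core_heyting : heyting_on da_core da_meet da_ten da_imp da_bot;
  da_split : forall a x y, da_core a -> da_gen x -> da_gen y ->
    da_imp a (da_join x y) = da_join (da_imp a x) (da_imp a y);
  da_dist : forall x y z, da_gen x -> da_gen y -> da_gen z ->
    da_ten x (da_join y z) = da_join (da_ten x y) (da_ten x z);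
  da_mon : forall x y z k, da_gen x -> da_gen y -> da_gen z -> da_gen k ->
    da_imp (da_imp x z) (da_imp (da_imp y k) (da_imp (da_ten x y) (da_ten z k)))
    = da_imp da_bot da_bot
}.

Lemma literal_mon_collapse (A : Type) (core : A -> Prop)
    (meet ten imp : A -> A -> A) (bot : A) :
  heyting_on core meet ten imp bot ->
  (forall x y z k, core x -> core y -> core z -> core k ->
     imp (imp x z) (imp y k) = imp (ten x y) (ten z k)) ->
  forall x, core x -> x = bot.
Proof.
move=> [[b0 bm bi mxx mC mA b_le res] tin tC tA tKU tKI] mon.
set one := imp bot bot.
have cone : core one by apply: bi.
have le1 x : core x -> meet x one = x.
  move=> cx; apply/res => //.
  have e : meet x bot = bot by rewrite mC // b_le.
  by rewrite e mxx.
have one_ten x : core x -> ten one x = one.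
  move=> cx; have ctx := tin _ _ cone cx.
  by rewrite -(le1 _ ctx) mC // tKI.
have impxx x : core x -> imp x x = one.
  move=> cx.
  have h : meet one (imp x x) = one by apply/res => //; rewrite -mA // mxx.
  by rewrite -h mC ?le1 //; apply: bi.
have imp1 x : core x -> imp one x = meet (imp one x) x.
  move=> cx; have cix := bi _ _ cone cx.
  have /res h : meet (imp one x) (imp one x) = imp one x by rewrite mxx.
  by rewrite -{1}(le1 (imp one x)) // -h // le1.
have one_bot : one = bot.
  have := mon one one one bot cone cone cone b0.
  have e : imp one bot = bot by rewrite imp1 // mC // ?b_le //; apply: bi.
  by rewrite !one_ten // impxx // !e => ->.
by move=> x cx; rewrite -(le1 x cx) one_bot mC // b_le.
Qed.

Definition da_top (A : depAlgebra) : A := da_imp (da_bot A) (da_bot A).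

Fixpoint da_eval (V : Type) (A : depAlgebra) (mu : V -> A) (f : dform V) : A :=
  match f with
  | DAtom p => mu p
  | DBot => da_bot A
  | DAnd g h => da_meet (da_eval mu g) (da_eval mu h)
  | DOr g h => da_join (da_eval mu g) (da_eval mu h)
  | DImp g h => da_imp (da_eval mu g) (da_eval mu h)
  | DTen g h => da_ten (da_eval mu g) (da_eval mu h)
  end.

Definition da_valid (V : Type) (A : depAlgebra) (f : dform V) : Prop :=
  forall mu : V -> A, (forall p, da_core (mu p)) -> da_eval mu f = da_top A.

Definition is_dinq_algebra (V : Type) (L : dform V -> Prop) (A : depAlgebra) : Prop :=
  forall f, L f -> da_valid A f.

(* Main.v *)
Require Import Defs.
From mathcomp Require Import all_boot generic_quotient boolp.

Set Implicit Arguments.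
Unset Strict Implicit.
Unset Printing Implicit Defensive.

(** Soundness: under a core valuation standard formulas take values in the core
    and all formulas take values in the generated subalgebra, so that every
    axiom is evaluated at elements for which the algebra laws are postulated.

    Completeness: the quotient of the formulas by interderivability is a Heyting
    algebra, whose core consists of the classes of standard formulas.  A core
    valuation into it comes from a standard substitution [s], and the value of
    [f] is the class of [f] under [s]; so a formula is valid in the quotient if
    and only if all its standard substitution instances are theorems. *)

(** * Heyting algebras carried by a subset *)

Section RelativeTheory.
Variables (A : Type) (D : A -> Prop) (meet join imp : A -> A -> A) (bot : A).

Local Notation "x =< y" := (meet x y = x) (at level 70, no associativity).
Local Notation top := (imp bot bot).

Section Brouwerian.
Hypothesis brouwer : brouwerian_on D meet imp bot.

Let bot_in := bs_bot_in brouwer.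
Let meet_in := bs_meet_in brouwer.
Let imp_in := bs_imp_in brouwer.
Hint Resolve bot_in meet_in imp_in : core.

Lemma bs_top_meet x : D x -> meet top x = x.
Proof.
move=> Dx; rewrite (bs_meetC brouwer); auto.
apply/(bs_residuation brouwer) => //.
by rewrite (bs_meetC brouwer Dx) // (bs_bot_le brouwer) // (bs_meetxx brouwer).
Qed.

Lemma bs_le_anti x y : D x -> D y -> x =< y -> y =< x -> x = y.
Proof. by move=> Dx Dy xy yx; rewrite -{1}xy (bs_meetC brouwer). Qed.

Lemma bs_le_trans y x z : D x -> D y -> D z -> x =< y -> y =< z -> x =< z.
Proof. by move=> Dx Dy Dz xy yz; rewrite -xy -(bs_meetA brouwer) // yz. Qed.

Lemma bs_meet_ler x y : D x -> D y -> meet x y =< y.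
Proof. by move=> Dx Dy; rewrite -(bs_meetA brouwer) // (bs_meetxx brouwer). Qed.

Lemma bs_meet_lel x y : D x -> D y -> meet x y =< x.
Proof. by move=> Dx Dy; rewrite (bs_meetC brouwer Dx) // bs_meet_ler. Qed.

Lemma bs_le_imp x y z : D x -> D y -> D z -> meet z x =< y -> z =< imp x y.
Proof. by move=> Dx Dy Dz; case: (bs_residuation brouwer Dx Dy Dz). Qed.

Lemma bs_le_imp_mp x y z :
  D x -> D y -> D z -> z =< imp x y -> z =< x -> z =< y.
Proof.
by move=> Dx Dy Dz /(bs_residuation brouwer Dx Dy Dz) zxy zx; rewrite -zx zxy.
Qed.

Lemma bs_le_impC x y z : D x -> D y -> D z -> z =< imp x y <-> x =< imp z y.
Proof.
by move=> Dx Dy Dz; rewrite -!(bs_residuation brouwer) // (bs_meetC brouwer Dx).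
Qed.

Lemma bs_imp_topP x y : D x -> D y -> imp x y = top <-> x =< y.
Proof.
move=> Dx Dy.
have -> : imp x y = top <-> top =< imp x y by rewrite bs_top_meet; auto.
by rewrite -(bs_residuation brouwer) ?bs_top_meet; auto.
Qed.

Lemma bs_imp_top_mp x y : D x -> D y -> imp x y = top -> x = top -> y = top.
Proof. by move=> Dx Dy /(bs_imp_topP Dx Dy)/[swap] ->; rewrite bs_top_meet. Qed.

Lemma bs_impxx x : D x -> imp x x = top.
Proof. by move=> Dx; apply/bs_imp_topP => //; apply: (bs_meetxx brouwer). Qed.

Lemma bs_impK x y : D x -> D y -> imp x (imp y x) = top.
Proof.
move=> Dx Dy; apply/bs_imp_topP; auto.
by apply: bs_le_imp; auto; apply: bs_meet_lel.
Qed.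

Lemma bs_impS x y z : D x -> D y -> D z ->
  imp (imp x (imp y z)) (imp (imp x y) (imp x z)) = top.
Proof.
move=> Dx Dy Dz; apply/bs_imp_topP; auto.
apply: bs_le_imp; auto; apply: bs_le_imp; auto.
set p := imp x (imp y z); set q := imp x y; set w := meet (meet p q) x.
have [Dp Dq] : D p /\ D q by rewrite /p /q; auto.
have Dw : D w by rewrite /w; auto.
have w_pq : w =< meet p q by apply: bs_meet_lel; auto.
have w_p : w =< p by apply: bs_le_trans w_pq _; auto; apply: bs_meet_lel.
have w_q : w =< q by apply: bs_le_trans w_pq _; auto; apply: bs_meet_ler.
have w_x : w =< x by apply: bs_meet_ler; auto.
by apply: (@bs_le_imp_mp y); rewrite //; apply: (@bs_le_imp_mp x); auto.
Qed.

Lemma bs_imp_meet x y : D x -> D y -> imp x (imp y (meet x y)) = top.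
Proof.
move=> Dx Dy; apply/bs_imp_topP; auto.
by apply: bs_le_imp; auto; apply: (bs_meetxx brouwer); auto.
Qed.

Lemma lub_heyting_on :
  (forall x y, D x -> D y -> D (join x y)) ->
  (forall x y, D x -> D y -> x =< join x y) ->
  (forall x y, D x -> D y -> y =< join x y) ->
  (forall x y z, D x -> D y -> D z -> x =< z -> y =< z -> join x y =< z) ->
  heyting_on D meet join imp bot.
Proof.
move=> join_in le_joinl le_joinr join_le.
have le_joinl_trans x y z : D x -> D y -> D z -> z =< x -> z =< join x y.
  by move=> *; apply: (@bs_le_trans x); auto.
have le_joinr_trans x y z : D x -> D y -> D z -> z =< y -> z =< join x y.
  by move=> *; apply: (@bs_le_trans y); auto.
split=> // [x y *|x y z *|x y Dx Dy].
- by apply: bs_le_anti; auto.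
- by apply: bs_le_anti; auto; apply: join_le; auto 6.
- apply: bs_le_anti; auto.
  by apply: join_le; auto; [apply: (bs_meetxx brouwer)|apply: bs_meet_lel].
Qed.

End Brouwerian.

Section Heyting.
Hypothesis heyting : heyting_on D meet join imp bot.

Let brouwer := ha_brouwerian heyting.
Let bot_in := bs_bot_in brouwer.
Let meet_in := bs_meet_in brouwer.
Let imp_in := bs_imp_in brouwer.
Let join_in := ha_join_in heyting.
Hint Resolve bot_in meet_in imp_in join_in : core.

Lemma ha_imp_joinl x y : D x -> D y -> imp x (join x y) = top.
Proof.
by move=> Dx Dy; apply/(bs_imp_topP brouwer); auto; apply: (ha_joinKI heyting).
Qed.

Lemma ha_imp_joinr x y : D x -> D y -> imp y (join x y) = top.
Proof. by move=> Dx Dy; rewrite (ha_joinC heyting) // ha_imp_joinl. Qed.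

Lemma ha_join_le x y z :
  D x -> D y -> D z -> x =< z -> y =< z -> join x y =< z.
Proof.
move=> Dx Dy Dz xz yz.
have join_absorb t : D t -> t =< z -> join t z = z.
  move=> Dt tz; rewrite (ha_joinC heyting) // -tz (bs_meetC brouwer) //.
  exact: (ha_meetKU heyting).
have -> : z = join (join x y) z by rewrite -(ha_joinA heyting) // !join_absorb.
by apply: (ha_joinKI heyting); auto.
Qed.

Lemma ha_imp_join x y z : D x -> D y -> D z ->
  imp (imp x z) (imp (imp y z) (imp (join x y) z)) = top.
Proof.
move=> Dx Dy Dz; apply/(bs_imp_topP brouwer); auto.
apply: (bs_le_imp brouwer); auto.
apply/(bs_le_impC brouwer); auto; apply: ha_join_le; auto;
  apply/(bs_le_impC brouwer); auto.
  by apply: (bs_meet_lel brouwer); auto.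
by apply: (bs_meet_ler brouwer); auto.
Qed.

Lemma ipl_axiom_sound (F : Type) (botF : F) (andF orF impF : F -> F -> F)
    (e : F -> A) f :
  (forall g, D (e g)) -> e botF = bot ->
  {morph e : g h / andF g h >-> meet g h} ->
  {morph e : g h / orF g h >-> join g h} ->
  {morph e : g h / impF g h >-> imp g h} ->
  ipl_axiom botF andF orF impF f -> e f = top.
Proof.
move=> De e0 eM eJ eI.
case=> [g h|g h k|g h|g h|g h|g h|g h|g h k|g]; rewrite ?eI ?eM ?eJ ?e0.
- exact: (bs_impK brouwer).
- exact: (bs_impS brouwer).
- by apply/(bs_imp_topP brouwer); auto; apply: (bs_meet_lel brouwer).
- by apply/(bs_imp_topP brouwer); auto; apply: (bs_meet_ler brouwer).
- exact: (bs_imp_meet brouwer).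
- exact: ha_imp_joinl.
- exact: ha_imp_joinr.
- exact: ha_imp_join.
- by apply/(bs_imp_topP brouwer); auto; apply: (bs_bot_le brouwer).
Qed.

End Heyting.

Section Restriction.
Variable E : A -> Prop.
Hypothesis E_sub : forall x, E x -> D x.
Hypothesis bot_in : E bot.
Hypothesis meet_in : forall x y, E x -> E y -> E (meet x y).
Hypothesis imp_in : forall x y, E x -> E y -> E (imp x y).

Lemma brouwerian_on_sub :
  brouwerian_on D meet imp bot -> brouwerian_on E meet imp bot.
Proof. by case=> *; split; auto. Qed.

Lemma heyting_on_sub : (forall x y, E x -> E y -> E (join x y)) ->
  heyting_on D meet join imp bot -> heyting_on E meet join imp bot.
Proof. by move=> join_in [? *]; split; auto; apply: brouwerian_on_sub. Qed.

End Restriction.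

End RelativeTheory.

(** * Soundness *)

Lemma mp_closure_sound (F A : Type) (D : A -> Prop) meet imp bot
    (impF : F -> F -> F) (S : F -> Prop) (e : F -> A) f :
  brouwerian_on D meet imp bot -> (forall g, D (e g)) ->
  {morph e : g h / impF g h >-> imp g h} ->
  (forall g, S g -> e g = imp bot bot) ->
  mp_closure impF S f -> e f = imp bot bot.
Proof.
move=> brouwer De eI S_top; elim=> [g /S_top //|g h _ gh _ g_top].
by apply: (bs_imp_top_mp brouwer (De g)); rewrite -?eI.
Qed.

Section InqSoundness.
Variables (V : Type) (A : inqAlgebra) (mu : V -> A).
Hypothesis mu_core : forall p, ia_core (mu p).

Let heyting := ia_heyting A.
Let brouwer := ha_brouwerian heyting.

Lemma ia_eval_gen f : ia_gen (ia_eval mu f).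
Proof.
elim: f => [p||g ? h ?|g ? h ?|g ? h ?] /=.
- exact: ig_core.
- exact: ig_bot.
- exact: ig_meet.
- exact: ig_join.
- exact: ig_imp.
Qed.

Lemma ia_eval_core f : standard f -> ia_core (ia_eval mu f).
Proof.
case: (ia_brouwerian A) => bot_in meet_in imp_in _ _ _ _ _.
by elim: f => //= g IHg h IHh /andP[/IHg ? /IHh ?]; auto.
Qed.

Lemma inqI_axiom_sound f : inqI_axiom f -> ia_eval mu f = ia_top A.
Proof.
have gen := ia_eval_gen.
case=> [{}f|a g h /ia_eval_core a_core]; first exact: (ipl_axiom_sound heyting).
rewrite /= (ia_split a_core) //; apply: (bs_impxx brouwer).
by apply: (ha_join_in heyting); apply: (bs_imp_in brouwer).
Qed.

End InqSoundness.

Lemma inq_sound (V : Type) (L : form V -> Prop) (A : inqAlgebra) f :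
  is_inq_algebra L A -> inq L f -> ia_valid A f.
Proof.
move=> AL Lf mu mu_core.
have brouwer := ha_brouwerian (ia_heyting A); have gen := ia_eval_gen mu_core.
apply: (mp_closure_sound (e := ia_eval mu) brouwer) Lf => // g.
case=> [|/AL]; last exact.
apply: (mp_closure_sound (e := ia_eval mu) brouwer) => // h.
exact: inqI_axiom_sound.
Qed.

Section DinqSoundness.
Variables (V : Type) (A : depAlgebra) (mu : V -> A).
Hypothesis mu_core : forall p, da_core (mu p).

Let heyting := da_heyting A.
Let brouwer := ha_brouwerian heyting.
Let core_heyting := da_core_heyting A.

Lemma da_eval_gen f : da_gen (da_eval mu f).
Proof.
elim: f => [p||g ? h ?|g ? h ?|g ? h ?|g ? h ?] /=.
- exact: dg_core.
- exact: dg_bot.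
- exact: dg_meet.
- exact: dg_join.
- exact: dg_imp.
- exact: dg_ten.
Qed.

Lemma da_eval_core f : dstandard f -> da_core (da_eval mu f).
Proof.
case: core_heyting => [[bot_in meet_in imp_in _ _ _ _ _] ten_in _ _ _ _].
by elim: f => //= g IHg h IHh /andP[/IHg ? /IHh ?]; auto.
Qed.

Lemma dinqI_axiom_sound f : dinqI_axiom f -> da_eval mu f = da_top A.
Proof.
have gen := da_eval_gen; have core := da_eval_core.
have ten_in x y : da_gen x -> da_gen y -> da_gen (da_ten x y) by apply: dg_ten.
case=> [{}f|a g h /core a_core|a b /core ? /core ?|a b /core ? /core ?
  |g h k|g h k l|a b c /core ? /core ? /core ?] /=.
- exact: (ipl_axiom_sound heyting).
- rewrite (da_split a_core) //; apply: (bs_impxx brouwer).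
  by apply: (ha_join_in heyting); apply: (bs_imp_in brouwer).
- exact: (ha_imp_joinl core_heyting).
- rewrite (ha_joinC core_heyting) //.
  by apply: (bs_impxx brouwer); apply: ten_in.
- rewrite da_dist //; apply: (bs_impxx brouwer).
  by apply: (ha_join_in heyting); apply: ten_in.
- exact: da_mon.
- exact: (ha_imp_join core_heyting).
Qed.

End DinqSoundness.

Lemma dinq_sound (V : Type) (L : dform V -> Prop) (A : depAlgebra) f :
  is_dinq_algebra L A -> dinq L f -> da_valid A f.
Proof.
move=> AL Lf mu mu_core.
have brouwer := ha_brouwerian (da_heyting A); have gen := da_eval_gen mu_core.
apply: (mp_closure_sound (e := da_eval mu) brouwer) Lf => // g.
case=> [|/AL]; last exact.
apply: (mp_closure_sound (e := da_eval mu) brouwer) => // h.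
exact: dinqI_axiom_sound.
Qed.

(** * The Lindenbaum algebra of an intuitionistic theory *)

Record ipl_theory (F : Type) (bot : F) (and or imp : F -> F -> F)
    (T : F -> Prop) : Prop := IplTheory {
  ipl_theory_axiom : forall f, ipl_axiom bot and or imp f -> T f;
  ipl_theory_mp : forall f g, T (imp f g) -> T f -> T g
}.

Local Open Scope quotient_scope.

Section Lindenbaum.
Variables (F : Type) (bot : F) (and or imp : F -> F -> F) (T : F -> Prop).
Hypothesis thy : ipl_theory bot and or imp T.

Local Notation "f |- g" := (T (imp f g)) (at level 70, no associativity).

Let T_axiom f : ipl_axiom bot and or imp f -> T f.
Proof. exact: ipl_theory_axiom thy f. Qed.

Let T_mp f g : T (imp f g) -> T f -> T g.
Proof. exact: ipl_theory_mp thy f g. Qed.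

Lemma entails_weaken f g : T g -> f |- g.
Proof. by apply: T_mp; apply: T_axiom; apply: ipl_k. Qed.

Lemma entails_mp f g h : f |- imp g h -> f |- g -> f |- h.
Proof.
by move=> fgh; apply: T_mp; apply: T_mp fgh; apply: T_axiom; apply: ipl_s.
Qed.

Lemma entails_refl f : f |- f.
Proof. by apply: (@entails_mp _ (imp f f)); apply: T_axiom; apply: ipl_k. Qed.

Lemma entails_trans g f h : f |- g -> g |- h -> f |- h.
Proof. by move=> fg gh; apply: entails_mp fg; apply: entails_weaken. Qed.

Lemma and_entailsl f g : and f g |- f.
Proof. by apply: T_axiom; apply: ipl_andl. Qed.

Lemma and_entailsr f g : and f g |- g.
Proof. by apply: T_axiom; apply: ipl_andr. Qed.

Lemma entails_and f g h : f |- g -> f |- h -> f |- and g h.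
Proof.
move=> fg; apply: entails_mp; apply: entails_trans fg _.
by apply: T_axiom; apply: ipl_andi.
Qed.

Lemma and_mono f f' g g' : f |- f' -> g |- g' -> and f g |- and f' g'.
Proof.
by move=> ff' gg'; apply: entails_and;
   [apply: entails_trans ff'; apply: and_entailsl
   |apply: entails_trans gg'; apply: and_entailsr].
Qed.

Lemma or_entailsl f g : f |- or f g.
Proof. by apply: T_axiom; apply: ipl_orl. Qed.

Lemma or_entailsr f g : g |- or f g.
Proof. by apply: T_axiom; apply: ipl_orr. Qed.

Lemma or_entails f g h : f |- h -> g |- h -> or f g |- h.
Proof.
by move=> fh; apply: T_mp; apply: T_mp fh; apply: T_axiom; apply: ipl_ore.
Qed.

Lemma or_mono f f' g g' : f |- f' -> g |- g' -> or f g |- or f' g'.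
Proof.
by move=> ff' gg'; apply: or_entails;
   [apply: entails_trans ff' _; apply: or_entailsl
   |apply: entails_trans gg' _; apply: or_entailsr].
Qed.

Lemma entails_imp f g h : f |- imp g h <-> and f g |- h.
Proof.
split=> fgh.
  apply: entails_mp (and_entailsr f g).
  by apply: entails_trans fgh; apply: and_entailsl.
apply: (@entails_trans (imp g (and f g))).
  by apply: T_axiom; apply: ipl_andi.
apply: (@T_mp (imp g (imp (and f g) h))); last exact: entails_weaken.
by apply: T_axiom; apply: ipl_s.
Qed.

Lemma imp_mono f f' g g' : f' |- f -> g |- g' -> imp f g |- imp f' g'.
Proof.
move=> f'f gg'; apply/entails_imp; apply: entails_trans gg'.
apply: (entails_mp (and_entailsl _ _)).
exact: entails_trans (and_entailsr _ _) f'f.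
Qed.

Definition interderivable (f g : F) : Prop := f |- g /\ g |- f.

Definition congruent (op : F -> F -> F) : Prop := forall f f' g g',
  interderivable f f' -> interderivable g g' ->
  interderivable (op f g) (op f' g').

Lemma congruent_and : congruent and.
Proof. by move=> f f' g g' [ff' f'f] [gg' g'g]; split; apply: and_mono. Qed.

Lemma congruent_or : congruent or.
Proof. by move=> f f' g g' [ff' f'f] [gg' g'g]; split; apply: or_mono. Qed.

Lemma congruent_imp : congruent imp.
Proof. by move=> f f' g g' [ff' f'f] [gg' g'g]; split; apply: imp_mono. Qed.

Definition interderivableb : rel {classic F} :=
  fun f g => `[< interderivable f g >].

Lemma interderivableb_refl : reflexive interderivableb.
Proof. by move=> f; apply/asboolP; split; apply: entails_refl. Qed.

Lemma interderivableb_sym : symmetric interderivableb.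
Proof. by move=> f g; apply/asboolP/asboolP; case. Qed.

Lemma interderivableb_trans : transitive interderivableb.
Proof.
move=> g f h /asboolP[fg gf] /asboolP[gh hg]; apply/asboolP.
by split; [apply: entails_trans fg gh|apply: entails_trans hg gf].
Qed.

Definition interderivable_equiv : equiv_rel {classic F} :=
  EquivRel interderivableb
    interderivableb_refl interderivableb_sym interderivableb_trans.

Definition lindenbaum : Type := {eq_quot interderivable_equiv}.

Definition lind_class (f : F) : lindenbaum :=
  \pi_{eq_quot interderivable_equiv} f.

(* Meaningful for congruent [op] only: otherwise the value depends on the
   representatives chosen by [repr]. *)
Definition lind_op (op : F -> F -> F) :
    lindenbaum -> lindenbaum -> lindenbaum :=
  lift_op2 {eq_quot interderivable_equiv} op.

Lemma lind_classP f g : lind_class f = lind_class g <-> interderivable f g.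
Proof. by split=> [/eqmodP/asboolP|fg]; last apply/eqmodP/asboolP. Qed.

Lemma lind_class_surj X : exists f, X = lind_class f.
Proof. by elim/quotW: X => f; exists f. Qed.

Lemma lind_opE op f g : congruent op ->
  lind_op op (lind_class f) (lind_class g) = lind_class (op f g).
Proof.
move=> op_congr; rewrite /lind_op -lock; apply/lind_classP.
by apply: op_congr; apply/lind_classP; apply: reprK.
Qed.

Lemma lind_andE f g :
  lind_op and (lind_class f) (lind_class g) = lind_class (and f g).
Proof. exact: lind_opE congruent_and. Qed.

Lemma lind_orE f g :
  lind_op or (lind_class f) (lind_class g) = lind_class (or f g).
Proof. exact: lind_opE congruent_or. Qed.

Lemma lind_impE f g :
  lind_op imp (lind_class f) (lind_class g) = lind_class (imp f g).
Proof. exact: lind_opE congruent_imp. Qed.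

Lemma lind_class_topP f :
  lind_class f = lind_op imp (lind_class bot) (lind_class bot) <-> T f.
Proof.
rewrite lind_impE lind_classP; split=> [[_ /T_mp]|Tf].
  by apply; apply: entails_refl.
by split; apply: entails_weaken; rewrite //; apply: entails_refl.
Qed.

Lemma lind_class_leP f g :
  lind_op and (lind_class f) (lind_class g) = lind_class f <-> f |- g.
Proof.
rewrite lind_andE lind_classP; split=> [[_ f_fg]|fg].
  exact: entails_trans f_fg (and_entailsr _ _).
by split; [apply: and_entailsl|apply: entails_and fg; apply: entails_refl].
Qed.

Lemma lind_brouwerian :
  brouwerian_on (fun=> True) (lind_op and) (lind_op imp) (lind_class bot).
Proof.
have andl := and_entailsl; have andr := and_entailsr.
split=> // [X _|X Y _ _|X Y Z _ _ _|X _|X Y Z _ _ _].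
- have [f ->] := lind_class_surj X.
  by apply/lind_class_leP; apply: entails_refl.
- have [[f ->] [g ->]] := (lind_class_surj X, lind_class_surj Y).
  by rewrite !lind_andE; apply/lind_classP; split; apply: entails_and.
- have [[f ->] [g ->]] := (lind_class_surj X, lind_class_surj Y).
  have [h ->] := lind_class_surj Z.
  rewrite !lind_andE; apply/lind_classP; split.
    by apply: entails_and; [apply: and_mono; [apply: entails_refl|]
      |apply: entails_trans (andr _ _) (andr _ _)].
  by apply: entails_and; [apply: entails_trans (andl _ _) (andl _ _)
    |apply: and_mono; [|apply: entails_refl]].
- have [f ->] := lind_class_surj X.
  by apply/lind_class_leP; apply: T_axiom; apply: ipl_bot.
- have [[f ->] [g ->]] := (lind_class_surj X, lind_class_surj Y).
  have [h ->] := lind_class_surj Z.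
  by rewrite lind_andE lind_impE !lind_class_leP entails_imp.
Qed.

Lemma lind_heyting :
  heyting_on (fun=> True) (lind_op and) (lind_op or) (lind_op imp)
    (lind_class bot).
Proof.
apply: (lub_heyting_on lind_brouwerian) => // [X Y _ _|X Y _ _|X Y Z _ _ _].
- have [[f ->] [g ->]] := (lind_class_surj X, lind_class_surj Y).
  by rewrite lind_orE; apply/lind_class_leP; apply: or_entailsl.
- have [[f ->] [g ->]] := (lind_class_surj X, lind_class_surj Y).
  by rewrite lind_orE; apply/lind_class_leP; apply: or_entailsr.
- have [[f ->] [g ->]] := (lind_class_surj X, lind_class_surj Y).
  have [h ->] := lind_class_surj Z.
  by rewrite lind_orE !lind_class_leP; apply: or_entails.
Qed.

Lemma lind_op_distr_or op a X Y : congruent op ->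
  (forall f g, f |- g -> op a f |- op a g) ->
  (forall f g, op a (or f g) |- or (op a f) (op a g)) ->
  lind_op op (lind_class a) (lind_op or X Y)
  = lind_op or (lind_op op (lind_class a) X) (lind_op op (lind_class a) Y).
Proof.
move=> op_congr op_mono op_or.
have [[f ->] [g ->]] := (lind_class_surj X, lind_class_surj Y).
rewrite lind_orE !lind_opE //; last exact: congruent_or.
apply/lind_classP; split=> //.
by apply: or_entails; apply: op_mono; [apply: or_entailsl|apply: or_entailsr].
Qed.

Section Core.
Variable std : pred F.

Definition lind_core (X : lindenbaum) : Prop :=
  exists2 f, std f & X = lind_class f.

Lemma lind_core_op op : congruent op ->
  (forall f g, std f -> std g -> std (op f g)) ->
  forall X Y, lind_core X -> lind_core Y -> lind_core (lind_op op X Y).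
Proof.
move=> op_congr std_op _ _ [f f_std ->] [g g_std ->].
by exists (op f g); [apply: std_op|apply: lind_opE].
Qed.

Lemma lind_core_brouwerian : std bot ->
  (forall f g, std f -> std g -> std (and f g)) ->
  (forall f g, std f -> std g -> std (imp f g)) ->
  brouwerian_on lind_core (lind_op and) (lind_op imp) (lind_class bot).
Proof.
move=> std_bot std_and std_imp; apply: brouwerian_on_sub lind_brouwerian => //.
- by exists bot.
- exact: lind_core_op congruent_and std_and.
- exact: lind_core_op congruent_imp std_imp.
Qed.

Lemma lind_core_valuation (V : Type) (mu : V -> lindenbaum) :
  (forall p, lind_core (mu p)) ->
  exists2 s : V -> F, (forall p, std (s p)) & mu = lind_class \o s.
Proof.
move=> mu_core.
have /choice[s sP] p : exists f, std f /\ mu p = lind_class f.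
  by case: (mu_core p) => f; exists f.
by exists s => [p|]; last apply/funext => p; case: (sP p).
Qed.

Lemma lind_imp_split a X Y :
  (forall b f g, std b -> imp b (or f g) |- or (imp b f) (imp b g)) ->
  lind_core a ->
  lind_op imp a (lind_op or X Y)
  = lind_op or (lind_op imp a X) (lind_op imp a Y).
Proof.
move=> split_axiom [b b_std ->]; apply: lind_op_distr_or => [|f g|f g].
- exact: congruent_imp.
- by apply: imp_mono; apply: entails_refl.
- exact: split_axiom.
Qed.

End Core.

End Lindenbaum.

Arguments lind_op {F bot and or imp T} thy op X Y : rename.
Arguments lind_core {F bot and or imp T} thy std X.

(** * Completeness *)

Section InqCompleteness.
Variables (V : Type) (L : form V -> Prop).

Lemma inq_axiom f : inqI_axiom f -> inq L f.
Proof. by move=> f_ax; apply: mp_base; left; apply: mp_base. Qed.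

Lemma inq_theory : ipl_theory Bot (@And V) (@Or V) (@Imp V) (inq L).
Proof.
split=> [f f_ax|]; last exact: mp_step.
by apply: inq_axiom; apply: inqI_ipl.
Qed.

Local Notation cls := (lind_class inq_theory).
Local Notation op := (lind_op inq_theory).
Local Notation core := (lind_core inq_theory (@standard V)).

Lemma inq_lindenbaum_heyting :
  heyting_on
    (inq_generated core (op (@And V)) (op (@Or V)) (op (@Imp V)) (cls Bot))
    (op (@And V)) (op (@Or V)) (op (@Imp V)) (cls Bot).
Proof.
apply: heyting_on_sub (lind_heyting inq_theory) => //.
- exact: ig_bot.
- exact: ig_meet.
- exact: ig_imp.
- exact: ig_join.
Qed.

Lemma inq_lindenbaum_brouwerian :
  brouwerian_on core (op (@And V)) (op (@Imp V)) (cls Bot).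
Proof. by apply: lind_core_brouwerian => // f g /= -> ->. Qed.

Lemma inq_lindenbaum_split X Y Z : core X ->
  op (@Imp V) X (op (@Or V) Y Z)
  = op (@Or V) (op (@Imp V) X Y) (op (@Imp V) X Z).
Proof.
by apply: lind_imp_split => *; apply: inq_axiom; apply: inqI_split.
Qed.

Definition inq_lindenbaum : inqAlgebra :=
  InqAlgebra inq_lindenbaum_heyting inq_lindenbaum_brouwerian
    (fun X Y Z X_core _ _ => inq_lindenbaum_split Y Z X_core).

Lemma inq_lindenbaum_eval (s : V -> form V) f :
  ia_eval (A := inq_lindenbaum) (cls \o s) f = cls (subst s f).
Proof.
elim: f => //= f -> g ->.
- exact: lind_andE.
- exact: lind_orE.
- exact: lind_impE.
Qed.

Lemma inq_lindenbaum_validP f : ia_valid inq_lindenbaum f <->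
  forall s : V -> form V, (forall p, standard (s p)) -> inq L (subst s f).
Proof.
split=> [f_valid s s_std|f_thm mu mu_core].
  apply/(lind_class_topP inq_theory); rewrite -inq_lindenbaum_eval.
  by apply: f_valid => p; exists (s p).
have [s s_std ->] := lind_core_valuation mu_core.
by rewrite inq_lindenbaum_eval; apply/lind_class_topP/f_thm.
Qed.

Lemma subst_Atom (f : form V) : subst (@Atom V) f = f.
Proof. by elim: f => //= f -> g ->. Qed.

Lemma inq_complete f : closed_std_subst L ->
  (forall A : inqAlgebra, is_inq_algebra L A -> ia_valid A f) -> inq L f.
Proof.
move=> L_subst f_valid; rewrite -(subst_Atom f).
apply: (iffLR (inq_lindenbaum_validP f)) => //.
apply: f_valid => g Lg; apply/inq_lindenbaum_validP => s s_std.
by apply: mp_base; right; apply: L_subst.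
Qed.

End InqCompleteness.

Section DinqCompleteness.
Variables (V : Type) (L : dform V -> Prop).

Lemma dinq_axiom f : dinqI_axiom f -> dinq L f.
Proof. by move=> f_ax; apply: mp_base; left; apply: mp_base. Qed.

Lemma dinq_theory : ipl_theory DBot (@DAnd V) (@DOr V) (@DImp V) (dinq L).
Proof.
split=> [f f_ax|]; last exact: mp_step.
by apply: dinq_axiom; apply: dinqI_ipl.
Qed.

Local Notation "f |- g" := (dinq L (DImp f g)) (at level 70, no associativity).
Local Notation cls := (lind_class dinq_theory).
Local Notation op := (lind_op dinq_theory).
Local Notation core := (lind_core dinq_theory (@dstandard V)).
Local Notation gen :=
  (dep_generated core (op (@DAnd V)) (op (@DOr V)) (op (@DImp V)) (op (@DTen V))
     (cls DBot)).

Lemma ten_mono f f' g g' : f |- f' -> g |- g' -> DTen f g |- DTen f' g'.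
Proof.
move=> ff'; apply: mp_step; apply: mp_step ff'.
by apply: dinq_axiom; apply: dinqI_ten_mon.
Qed.

Lemma congruent_ten : congruent (@DImp V) (dinq L) (@DTen V).
Proof. by move=> f f' g g' [ff' f'f] [gg' g'g]; split; apply: ten_mono. Qed.

Lemma std_entails_tenl a b : dstandard a -> dstandard b -> a |- DTen a b.
Proof. by move=> *; apply: dinq_axiom; apply: dinqI_ten_intro. Qed.

Lemma std_entails_tenr a b : dstandard a -> dstandard b -> b |- DTen a b.
Proof.
move=> a_std b_std; apply: (entails_trans dinq_theory (g := DTen b a)).
  exact: std_entails_tenl.
by apply: dinq_axiom; apply: dinqI_ten_comm.
Qed.

Lemma std_ten_entails a b c : dstandard a -> dstandard b -> dstandard c ->
  a |- c -> b |- c -> DTen a b |- c.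
Proof.
move=> a_std b_std c_std ac; apply: mp_step; apply: mp_step ac.
by apply: dinq_axiom; apply: dinqI_ten_elim.
Qed.

Lemma dinq_lind_tenE f g : op (@DTen V) (cls f) (cls g) = cls (DTen f g).
Proof. exact: lind_opE congruent_ten. Qed.

Lemma dinq_lindenbaum_heyting :
  heyting_on gen (op (@DAnd V)) (op (@DOr V)) (op (@DImp V)) (cls DBot).
Proof.
apply: heyting_on_sub (lind_heyting dinq_theory) => //.
- exact: dg_bot.
- exact: dg_meet.
- exact: dg_imp.
- exact: dg_join.
Qed.

Lemma dinq_lindenbaum_core_heyting :
  heyting_on core (op (@DAnd V)) (op (@DTen V)) (op (@DImp V)) (cls DBot).
Proof.
apply: lub_heyting_on.
- by apply: lind_core_brouwerian => // f g /= -> ->.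
- by apply: lind_core_op congruent_ten _ => f g /= -> ->.
- move=> _ _ [a a_std ->] [b b_std ->]; rewrite dinq_lind_tenE.
  by apply/lind_class_leP; apply: std_entails_tenl.
- move=> _ _ [a a_std ->] [b b_std ->]; rewrite dinq_lind_tenE.
  by apply/lind_class_leP; apply: std_entails_tenr.
- move=> _ _ _ [a a_std ->] [b b_std ->] [c c_std ->].
  by rewrite dinq_lind_tenE !lind_class_leP; apply: std_ten_entails.
Qed.

Lemma dinq_lindenbaum_split X Y Z : core X ->
  op (@DImp V) X (op (@DOr V) Y Z)
  = op (@DOr V) (op (@DImp V) X Y) (op (@DImp V) X Z).
Proof.
by apply: lind_imp_split => *; apply: dinq_axiom; apply: dinqI_split.
Qed.

Lemma dinq_lindenbaum_dist X Y Z :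
  op (@DTen V) X (op (@DOr V) Y Z)
  = op (@DOr V) (op (@DTen V) X Y) (op (@DTen V) X Z).
Proof.
have [f ->] := lind_class_surj X; apply: lind_op_distr_or => [|g h|g h].
- exact: congruent_ten.
- exact: ten_mono (entails_refl dinq_theory f).
- by apply: dinq_axiom; apply: dinqI_ten_dist.
Qed.

Lemma dinq_lindenbaum_mon X Y Z W :
  op (@DImp V) (op (@DImp V) X Z) (op (@DImp V) (op (@DImp V) Y W)
    (op (@DImp V) (op (@DTen V) X Y) (op (@DTen V) Z W)))
  = op (@DImp V) (cls DBot) (cls DBot).
Proof.
have [[f ->] [g ->]] := (lind_class_surj X, lind_class_surj Y).
have [[h ->] [k ->]] := (lind_class_surj Z, lind_class_surj W).
rewrite ![in LHS](dinq_lind_tenE, lind_impE).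
apply/(lind_class_topP dinq_theory).
by apply: dinq_axiom; apply: dinqI_ten_mon.
Qed.

Definition dinq_lindenbaum : depAlgebra :=
  DepAlgebra dinq_lindenbaum_heyting dinq_lindenbaum_core_heyting
    (fun X Y Z X_core _ _ => dinq_lindenbaum_split Y Z X_core)
    (fun X Y Z _ _ _ => dinq_lindenbaum_dist X Y Z)
    (fun X Y Z W _ _ _ _ => dinq_lindenbaum_mon X Y Z W).

Lemma dinq_lindenbaum_eval (s : V -> dform V) f :
  da_eval (A := dinq_lindenbaum) (cls \o s) f = cls (dsubst s f).
Proof.
elim: f => //= f -> g ->.
- exact: lind_andE.
- exact: lind_orE.
- exact: lind_impE.
- exact: dinq_lind_tenE.
Qed.

Lemma dinq_lindenbaum_validP f : da_valid dinq_lindenbaum f <->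
  forall s : V -> dform V, (forall p, dstandard (s p)) -> dinq L (dsubst s f).
Proof.
split=> [f_valid s s_std|f_thm mu mu_core].
  apply/(lind_class_topP dinq_theory); rewrite -dinq_lindenbaum_eval.
  by apply: f_valid => p; exists (s p).
have [s s_std ->] := lind_core_valuation mu_core.
by rewrite dinq_lindenbaum_eval; apply/lind_class_topP/f_thm.
Qed.

Lemma dsubst_DAtom (f : dform V) : dsubst (@DAtom V) f = f.
Proof. by elim: f => //= f -> g ->. Qed.

Lemma dinq_complete f : dclosed_std_subst L ->
  (forall A : depAlgebra, is_dinq_algebra L A -> da_valid A f) -> dinq L f.
Proof.
move=> L_subst f_valid; rewrite -(dsubst_DAtom f).
apply: (iffLR (dinq_lindenbaum_validP f)) => //.
apply: f_valid => g Lg; apply/dinq_lindenbaum_validP => s s_std.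
by apply: mp_base; right; apply: L_subst.
Qed.

End DinqCompleteness.

Theorem theorem2p15 (V : countType) :
  (forall L : form V -> Prop,
     (forall f, L f -> standard f) -> closed_std_subst L ->
     forall f : form V,
       inq L f <-> (forall A : inqAlgebra, is_inq_algebra L A -> ia_valid A f))
  /\
  (forall L : dform V -> Prop,
     (forall f, L f -> dstandard f) -> dclosed_std_subst L ->
     forall f : dform V,
       dinq L f <-> (forall A : depAlgebra, is_dinq_algebra L A -> da_valid A f)).
Proof.
split=> L _ L_subst f; split.
- by move=> Lf A AL; apply: inq_sound Lf.
- exact: inq_complete.
- by move=> Lf A AL; apply: dinq_sound Lf.
- exact: dinq_complete.
Qed.
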